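(* Let $X$ be a finite set. Given the Dowker complex and the differential weight of a relation between $X$ and a finite set, the relation can be reconstructed up to a bijection on the second set. That is: let $Y,Y'$ be finite sets and let $R\subseteq X\times Y$, $R'\subseteq X\times Y'$ be relations such that $D(X,Y,R)=D(X,Y',R')$ and the differential weights $d$ of $R$ and $d'$ of $R'$ agree on this complex. Then there is a bijection $g:Y\to Y'$ such that for all $x\in X$ and $y\in Y$, $(x,y)\in R$ if and only if $(x,g(y))\in R'$.
   Context: For finite sets $X,Y$ and a relation $R\subseteq X\times Y$, the Dowker complex $D(X,Y,R)$ is the abstract simplicial complex on the vertex set $X$ consisting of all subsets $\sigma\subseteq X$ for which there is a $y\in Y$ with $(x,y)\in R$ for all $x\in\sigma$. The empty simplex $\emptyset$ is included (whenever $Y\neq\emptyset$). The differential weight of $R$ is the function $d:D(X,Y,R)\to\mathbb{N}$ given by $$d(\sigma)=\#\{y\in Y : (x,y)\in R \text{ for all } x\in\sigma, \text{ and } (x,y)\notin R \text{ for all } x\in X\setminus\sigma\}.$$ *)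

(* Defs.v *)
From mathcomp Require Import all_boot.

Set Implicit Arguments.
Unset Strict Implicit.
Unset Printing Implicit Defensive.

(* The complex is given by its set of simplices; its vertex set is the whole
   type X, even if some singleton [set x] is not a simplex. With s := set0 the
   condition reduces to the existence of some y : Y. *)
Definition dowker (X Y : finType) (R : {set X * Y}) : {set {set X}} :=
  [set s : {set X} | [exists y : Y, [forall x in s, (x, y) \in R]]].

(* Given by its formula on every subset of X; it is meant to be used as a
   function on the simplices of dowker R only. *)
Definition diff_weight (X Y : finType) (R : {set X * Y}) (s : {set X}) : nat :=
  #|[set y : Y | [forall x in s, (x, y) \in R]
               & [forall x in ~: s, (x, y) \notin R]]|.

(* Main.v *)
(* The differential weight counts the columns y of R whose set of related
   points is exactly s. It vanishes outside the Dowker complex, so the column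
   maps of R and R' have equinumerous fibres over every subset of X, and
   matching the fibres yields the bijection. *)
Require Import Defs.
From mathcomp Require Import all_boot.

(* Choosing in each fibre the element of the same enumeration rank makes
   injectivity immediate: the value and the rank determine an element. *)
Lemma fiber_injection (T : eqType) (Y Y' : finType) (f : Y -> T) (f' : Y' -> T) :
  (forall t, #|[pred y | f y == t]| <= #|[pred y | f' y == t]|) ->
  exists2 g : Y -> Y', injective g & forall y, f' (g y) = f y.
Proof.
move=> le_fib.
pose rank (Z : finType) (h : Z -> T) z := index z (enum [pred w | h w == h z]).
have /fin_all_exists [g gP] y :
    exists y', f' y' = f y /\ rank Y' f' y' = rank Y f y.
  have y_fib : y \in enum [pred w | f w == f y] by rewrite mem_enum inE.
  have lt_rank : rank Y f y < size (enum [pred w | f' w == f y]).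
    by rewrite -cardE (leq_trans _ (le_fib _)) // cardE index_mem.
  (* The fibre of [f'] is nonempty because its size exceeds a rank; [y'] only serves as the default
     value of [nth]. *)
  have [y' _] : exists y', y' \in [pred w | f' w == f y].
    by apply/card_gt0P; rewrite cardE (leq_ltn_trans _ lt_rank).
  have := mem_nth y' lt_rank; rewrite mem_enum inE => /eqP f'E.
  exists (nth y' (enum [pred w | f' w == f y]) (rank Y f y)).
  by split=> //; rewrite {1}/rank f'E index_uniq ?enum_uniq.
exists g => [y1 y2 eq_g|y]; last by case: (gP y).
have [[f1 r1] [f2 r2]] := (gP y1, gP y2).
have eq_f : f y1 = f y2 by rewrite -f1 -f2 eq_g.
have : rank Y f y1 = rank Y f y2 by rewrite -r1 -r2 eq_g.
(* By [eq_f] both ranks are positions in one and the same enumeration, which contains [y1] and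
   [y2]. *)
by rewrite /rank eq_f; apply: (index_inj y1); rewrite mem_enum inE ?eq_f.
Qed.

(** Injections exist in both directions; the backward one serves only to bound the cardinality of
    [Y'] by that of [Y], which makes the forward one bijective. *)
Lemma fiber_bijection (T : eqType) (Y Y' : finType) (f : Y -> T) (f' : Y' -> T) :
  (forall t, #|[pred y | f y == t]| = #|[pred y | f' y == t]|) ->
  exists2 g : Y -> Y', bijective g & forall y, f' (g y) = f y.
Proof.
move=> eq_fib.
have [|g g_inj gf] := @fiber_injection T Y Y' f f' => [t|].
  by rewrite eq_fib.
have [|h /leq_card le_card _] := @fiber_injection T Y' Y f' f => [t|].
  by rewrite eq_fib.
by exists g => //; apply: inj_card_bij.
Qed.

Definition column {X Y : finType} (R : {set X * Y}) (y : Y) : {set X} :=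
  [set x | (x, y) \in R].

Lemma diff_weightE (X Y : finType) (R : {set X * Y}) (s : {set X}) :
  diff_weight R s = #|[pred y | column R y == s]|.
Proof.
apply: eq_card => y; rewrite !inE; apply/andP/eqP => [[/forall_inP sR /forall_inP sCR]|<-].
  apply/setP => x; rewrite inE; case: (boolP (x \in s)) => [/sR //|xNs].
  by apply/negbTE/sCR; rewrite inE.
by split; apply/forall_inP => x; rewrite !inE.
Qed.

Lemma diff_weight_notin_dowker (X Y : finType) (R : {set X * Y}) (s : {set X}) :
  s \notin dowker R -> diff_weight R s = 0.
Proof.
move=> sND; apply/eqP; rewrite cards_eq0; apply/eqP/setP => y; rewrite !inE.
apply: contraNF sND => /andP[sR _]; rewrite inE.
by apply/existsP; exists y.
Qed.

Theorem theorem1 (X Y Y' : finType) (R : {set X * Y}) (R' : {set X * Y'})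
    (eqD : dowker R = dowker R')
    (eqd : forall s : {set X}, s \in dowker R ->
             diff_weight R s = diff_weight R' s) :
  exists g : Y -> Y', bijective g /\
    (forall (x : X) (y : Y), (x, y) \in R <-> (x, g y) \in R').
Proof.
have [|g g_bij gR] := @fiber_bijection _ _ _ (column R) (column R') => [s|].
  (* Outside the complex [eqd] says nothing, but by [eqD] the set [s] is then a simplex of neither
     complex, so both weights are zero. *)
  rewrite -!diff_weightE; case: (boolP (s \in dowker R)) => [/eqd //|sND].
  by rewrite !diff_weight_notin_dowker // -eqD.
exists g; split=> // x y.
by have /setP/(_ x) := gR y; rewrite !inE => ->.
Qed.
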